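(* The graded superalgebra $OSym$ is generated by $o:=e_1$ and the elements $e_{2r}$ ($r\ge1$), subject only to the relations $$[e_{2r},e_{2s}]=0,\qquad [o^2,e_{2r}]=0,\qquad [o,e_{2r+2}]=\Big[\tfrac12(oe_{2r}+e_{2r}o),\,e_2\Big]$$ for all $r,s\ge1$, where $[a,b]:=ab-ba$.
   Context: $\Bbbk$ is an algebraically closed field of characteristic $\neq2$. The algebra of odd symmetric functions $OSym$ is the graded superalgebra generated by elements $h_r$ ($r\ge1$) of degree $2r$ and parity $r\bmod 2$, subject to (with $h_0:=1$), for $r\ge0,s\ge1$: $h_rh_s=h_sh_r$ if $r\equiv s\pmod 2$, and $h_rh_s+(-1)^rh_sh_r=(-1)^rh_{r+1}h_{s-1}+h_{s-1}h_{r+1}$ if $r\not\equiv s\pmod 2$. Elements $e_r$ ($r\ge0$) are defined recursively by $\sum_{s=0}^r(-1)^se_sh_{r-s}=\delta_{r,0}$; so $e_r$ has degree $2r$ and parity $r\bmod2$, and $e_1=h_1$. *)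

(* Defs.v *)
From HB Require Import structures.
From mathcomp Require Import all_boot all_order all_algebra.
From mathcomp Require Export finmap.
From mathcomp.multinomials Require Export monalg.

Set Implicit Arguments.
Unset Strict Implicit.
Unset Printing Implicit Defensive.

Import GRing.Theory.
Local Open Scope ring_scope.

Definition FreeAlg (k : fieldType) := {malg k[fmonom nat]}.

Definition gen (k : fieldType) (i : nat) : FreeAlg k := << fmu i >>.

Definition in_ideal (k : fieldType) (S : FreeAlg k -> Prop) (p : FreeAlg k) : Prop :=
  exists l : seq (FreeAlg k * FreeAlg k * FreeAlg k),
    (forall t, t \in l -> S t.1.2) /\
    p = \sum_(t <- l) t.1.1 * t.1.2 * t.2.

Definition comm (R : ringType) (a b : R) := a * b - b * a.

(* ---------- OSym: generators h_r (r >= 1); letter i encodes h_(i+1) ---------- *)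
Definition hH (k : fieldType) (r : nat) : FreeAlg k :=
  if r is r'.+1 then gen k r' else 1.

Definition relOSym (k : fieldType) (p : FreeAlg k) : Prop :=
  exists r s : nat, (1 <= s)%N /\
   ((odd r = odd s /\ p = hH k r * hH k s - hH k s * hH k r)
    \/
    (odd r <> odd s /\
     p = hH k r * hH k s + (-1) ^+ r * (hH k s * hH k r)
         - ((-1) ^+ r * (hH k r.+1 * hH k s.-1) + hH k s.-1 * hH k r.+1))).

(* representatives of e_0, ..., e_n in the free algebra on the h's, defined by
   sum_{s=0}^r (-1)^s e_s h_{r-s} = delta_{r,0}, i.e.
   e_0 = 1 and e_r = (-1)^(r+1) sum_{s<r} (-1)^s e_s h_{r-s} for r >= 1. *)
Fixpoint elist (k : fieldType) (n : nat) : seq (FreeAlg k) :=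
  match n with
  | 0 => [:: 1]
  | n'.+1 =>
      let l := elist k n' in
      rcons l ((-1) ^+ n'.+2 *
               \sum_(s < n'.+1) (-1) ^+ s * (l`_s * hH k (n'.+1 - s)))
  end.

Definition eH (k : fieldType) (r : nat) : FreeAlg k := (elist k r)`_r.

(* ---------- new presentation: letter 0 encodes o, letter r >= 1 encodes e_(2r) ---------- *)
Definition oX (k : fieldType) : FreeAlg k := gen k 0.
Definition EX (k : fieldType) (r : nat) : FreeAlg k := gen k r.

Definition relNew (k : fieldType) (p : FreeAlg k) : Prop :=
  exists r s : nat, (1 <= r)%N /\ (1 <= s)%N /\
   (p = comm (EX k r) (EX k s)
    \/ p = comm (oX k * oX k) (EX k r)
    \/ p = comm (oX k) (EX k r.+1)
           - comm ((2%:R)^-1 *: (oX k * EX k r + EX k r * oX k)) (EX k 1)).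

Definition imgX (k : fieldType) (i : nat) : FreeAlg k :=
  if i is 0 then eH k 1 else eH k (2 * i).

Definition phi (k : fieldType) (q : FreeAlg k) : FreeAlg k :=
  \sum_(m <- msupp q) q@_m *: \prod_(i <- fmonom_val m) imgX k i.

(* Main.v *)
(* The two presentations are shown to imply each other's relations, so no basis
   of OSym is needed.

   The relations between h_s, h_(s-1) and all the h_r say that, with
   H(t) = sum_r h_r t^r,
     H(t) (t h_s - h_(s-1)) = - (t h_s + h_(s-1)) H(-t)   for s odd,
     H(t) (t h_s + h_(s-1)) = (t h_s + h_(s-1)) H(t)      for s even.
   Multiplying by E(-t) = H(t)^-1 on both sides gives relations between the e_r
   and the h_s; sorting these by e_r instead of h_s and inverting H(t) once more
   shows that the e_r satisfy the same relations as the h_r, and conversely.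
   It then remains to compare the relations of the e_r with those of o and
   E_r = e_(2r), where e_(2r+1) = (o E_r + E_r o) / 2: there [e_(2a+1), E_(b+1)]
   is symmetric in a and b, and its anticommutator with o yields
   [e_(2a+1), e_(2b+3)] = [e_(2b+1), e_(2a+3)], whence [e_(2a+1), e_(2b+1)] = 0
   by induction on a. *)
Require Import Defs.
From Stdlib Require Import Ncring Ncring_tac.
From HB Require Import structures.
From mathcomp Require Import all_boot all_order all_algebra.
From mathcomp Require boolp.

Set Implicit Arguments.
Unset Strict Implicit.
Unset Printing Implicit Defensive.

Import GRing.Theory.
Local Open Scope ring_scope.

(** * Noncommutative ring normalisation *)

#[local] Instance nc_ops (R : pzRingType) :
  @Ncring.Ring_ops R 0 1 +%R *%R (fun x y => x - y) -%R eq := {}.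

#[local] Instance nc_ring (R : pzRingType) :
  @Ncring.Ring R 0 1 +%R *%R (fun x y => x - y) -%R eq (nc_ops R).
Proof.
split; try exact _.
- exact: (@add0r R).
- exact: (@addrC R).
- exact: (@addrA R).
- exact: (@mul1r R).
- exact: (@mulr1 R).
- exact: (@mulrA R).
- exact: (@mulrDl R).
- by move=> x y z; exact: (@mulrDr R).
- by [].
- exact: (@subrr R).
Qed.

(** For a well-chosen known relation [c = d], the remaining goal [a - b = c - d] is an identity of
    all rings, within reach of [non_commutative_ring]. *)
Lemma eq_of_subr_eq (V : zmodType) (a b c d : V) :
  c = d -> a - b = c - d -> a = b.
Proof. by move=> -> /eqP; rewrite subrr subr_eq0 => /eqP. Qed.

Lemma eqrD (V : zmodType) (a b c d : V) : a = b -> c = d -> a + c = b + d.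
Proof. by move=> -> ->. Qed.

Lemma eqrB (V : zmodType) (a b c d : V) : a = b -> c = d -> a - c = b - d.
Proof. by move=> -> ->. Qed.

(** * Cauchy products of sequences *)

Definition conv (R : pzRingType) (a b : nat -> R) (n : nat) : R :=
  \sum_(i < n.+1) a i * b (n - i)%N.

Definition conv1 (R : pzRingType) (n : nat) : R := (n == 0)%:R.

Definition alt (R : pzRingType) (a : nat -> R) (n : nat) : R := (-1) ^+ n * a n.

Definition lin (R : pzRingType) (y x : R) (n : nat) : R :=
  match n with 0 => y | 1 => x | _ => 0 end.

Section Conv.
Variable R : pzRingType.
Implicit Types a b c : nat -> R.

Lemma eq_conv a a' b b' : a =1 a' -> b =1 b' -> conv a b =1 conv a' b'.
Proof. by move=> aE bE n; apply: eq_bigr => i _; rewrite aE bE. Qed.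

Lemma convA a b c : conv a (conv b c) =1 conv (conv a b) c.
Proof.
move=> n; pose T (j k : nat) := a j * (b (n - j - k)%N * c k).
transitivity (\sum_(j < n.+1) \sum_(k < n.+1 | (k <= n - j)%N) T j k).
  apply: eq_bigr => j _; rewrite big_distrr /=.
  rewrite (big_ord_narrow_leq (leq_subr _ _)) /=.
  rewrite (reindex_inj rev_ord_inj) /=; apply: eq_bigr => k _.
  by rewrite /T subSS subKn // -ltnS.
rewrite (exchange_big_dep predT) //= [RHS](reindex_inj rev_ord_inj) /=.
apply: eq_bigr => k _.
transitivity (\sum_(j < n.+1 | (j <= n - k)%N) T j k).
  apply: eq_bigl => j; rewrite -ltnS -(ltnS j) -!subSn ?leq_ord //.
  by rewrite -subn_gt0 -(subn_gt0 j) -!subnDA addnC.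
rewrite (big_ord_narrow_leq (leq_subr _ _)) subSS subKn -1?ltnS // big_distrl /=.
by apply: eq_bigr => j _; rewrite /T -!subnDA addnC mulrA.
Qed.

Lemma conv1l a : conv (conv1 R) a =1 a.
Proof.
move=> n; rewrite /conv big_ord_recl mul1r subn0 big1 ?addr0 // => i _.
by rewrite mul0r.
Qed.

Lemma conv1r a : conv a (conv1 R) =1 a.
Proof.
move=> n; rewrite /conv big_ord_recr /= subnn mulr1 big1 ?add0r // => i _.
by rewrite /conv1 subn_eq0 leqNgt ltn_ord mulr0.
Qed.

Lemma conv_alt a b : conv (alt a) (alt b) =1 alt (conv a b).
Proof.
move=> n; rewrite /alt /conv mulr_sumr; apply: eq_bigr => i _.
have -> : (-1) ^+ n = (-1) ^+ i * (-1) ^+ (n - i) :> R.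
  by rewrite -exprD subnKC // -ltnS.
rewrite -!mulrA; congr (_ * _); rewrite !mulrA; congr (_ * _).
exact: commr_sign.
Qed.

Lemma alt_conv1 : alt (conv1 R) =1 conv1 R.
Proof. by case=> [|n]; rewrite /alt /conv1 ?mulr1 ?mulr0. Qed.

Lemma altK a : alt (alt a) =1 a.
Proof. by move=> n; rewrite /alt mulrA -exprD addnn -signr_odd odd_double mul1r. Qed.

Lemma conv_linr a y x n : conv a (lin y x) n.+1 = a n.+1 * y + a n * x.
Proof.
rewrite /conv !big_ord_recr /= subnn subSnn big1 ?add0r 1?addrC // => i _.
by rewrite subSn ?(ltnW (ltn_ord i)) // -[(n - i)%N]prednK ?subn_gt0 //= mulr0.
Qed.

Lemma conv_linl a y x n : conv (lin y x) a n.+1 = y * a n.+1 + x * a n.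
Proof.
rewrite /conv !big_ord_recl /= subn0 subSS subn0 big1 ?addr0 // => i _.
by rewrite mul0r.
Qed.

Lemma conv_at0 a b : conv a b 0 = a 0 * b 0.
Proof. by rewrite /conv big_ord_recl big_ord0 addr0. Qed.

(** Strong induction: since [a 0 = 1], the coefficient of index [n] is the [n]-th term itself plus
    contributions of smaller indices, which cancel. *)
Lemma conv_inj a b c : a 0 = 1 -> conv a b =1 conv a c -> b =1 c.
Proof.
move=> a0 abc; elim/ltn_ind => n IHn; move: (abc n).
rewrite /conv !big_ord_recl a0 !mul1r subn0 => /eqP; rewrite eq_sym -subr_eq0.
rewrite opprD addrACA -sumrB big1 ?addr0 ?subr_eq0; first by move/eqP.
by move=> i _; rewrite IHn ?subrr // ltn_subrL /= (leq_trans _ (ltn_ord i)).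
Qed.

(** Cancel [a] on the left in a(ba) = (ab)a = a. *)
Lemma conv_inv_sym a b : a 0 = 1 -> conv a b =1 conv1 R -> conv b a =1 conv1 R.
Proof.
move=> a0 ab; apply: (conv_inj a0) => n.
by rewrite convA (eq_conv ab (frefl _)) conv1l conv1r.
Qed.

(** The computation b = b(ab') = (ba)b' = b', once b' is known to be a right inverse too. *)
Lemma conv_inv_uniq a b b' : a 0 = 1 ->
  conv b a =1 conv1 R -> conv b' a =1 conv1 R -> b =1 b'.
Proof.
move=> a0 ba b'a n.
have b'0 : b' 0 = 1 by have := b'a 0; rewrite conv_at0 a0 mulr1.
rewrite -[LHS]conv1r -(eq_conv (frefl b) (conv_inv_sym b'0 b'a)) convA.
by rewrite (eq_conv ba (frefl b')) conv1l.
Qed.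

(* a(t) (y + x t) = (y + x' t) b(t) turns into
   A(t) (y + x' t) = (y + x t) B(t) for the inverse series A, B of a, b. *)
Lemma conv_inv_intertwine a b A B x x' y :
    a 0 = 1 -> b 0 = 1 -> conv A a =1 conv1 R -> conv B b =1 conv1 R ->
    (forall r, a r.+1 * y + a r * x = y * b r.+1 + x' * b r) ->
  forall r, A r.+1 * y + A r * x' = y * B r.+1 + x * B r.
Proof.
move=> a0 b0 Aa Bb ab r.
have B0 : B 0 = 1 by have := Bb 0; rewrite conv_at0 b0 mulr1.
have bB := conv_inv_sym B0 Bb.
have mn : conv a (lin y x) =1 conv (lin y x') b.
  by case=> [|n]; rewrite ?conv_at0 ?a0 ?b0 ?mul1r ?mulr1 // conv_linr conv_linl.
rewrite -conv_linr -conv_linl.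
transitivity (conv A (conv (conv (lin y x') b) B) r.+1).
  apply: eq_conv => // n.
  by rewrite -convA (eq_conv (frefl _) bB) conv1r.
transitivity (conv A (conv (conv a (lin y x)) B) r.+1).
  by apply: eq_conv => //; apply: eq_conv => // n; rewrite mn.
rewrite (eq_conv (frefl A) (fsym (convA a (lin y x) B))) convA.
by rewrite (eq_conv Aa (frefl _)) conv1l.
Qed.

End Conv.

(** * Odd symmetric sequences and their inverse series *)

(** The defining relations of OSym, asked of a sequence in any ring so that they apply to the h's
    and the e's alike. The index [s] is lowered by one, so that [r] and [s] have equal parity in the
    mixed relations, and the sign (-1)^r is resolved by cases. *)
Record odd_symmetric (R : pzRingType) (h : nat -> R) : Prop := OddSymmetric {
  os0 : h 0 = 1;
  os_comm : forall r s, odd r = odd s -> h r * h s = h s * h r;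
  os_even : forall r s, ~~ odd r -> ~~ odd s ->
    h r * h s.+1 + h s.+1 * h r = h s * h r.+1 + h r.+1 * h s;
  os_odd : forall r s, odd r -> odd s ->
    h r * h s.+1 - h s.+1 * h r = h s * h r.+1 - h r.+1 * h s }.

Section OddInverse.
Variables (R : pzRingType) (h e : nat -> R).
Hypothesis hP : odd_symmetric h.
Hypothesis eh : conv (alt e) h =1 conv1 R.

Let alt_odd a r : odd r -> alt a r = - a r :> R.
Proof. by move=> r1; rewrite /alt -signr_odd r1 expr1 mulN1r. Qed.

Let alt_even a r : ~~ odd r -> alt a r = a r :> R.
Proof. by move=> r1; rewrite /alt -signr_odd (negbTE r1) mul1r. Qed.

Let alt0 (a : nat -> R) : alt a 0 = a 0.
Proof. exact: alt_even. Qed.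

Lemma conv_inv0 : e 0 = 1.
Proof. by have := eh 0; rewrite conv_at0 (os0 hP) mulr1 alt0. Qed.

(** Substitute -t for t in E(-t)H(t) = 1. *)
Lemma conv_alt_inv : conv e (alt h) =1 conv1 R.
Proof.
move=> n; rewrite -(eq_conv (altK e) (frefl _)) conv_alt -alt_conv1.
by rewrite /alt eh.
Qed.

Let h0 := os0 hP.
Let alth0 : alt h 0 = 1. Proof. by rewrite alt0. Qed.

(** Coefficients of H(t)(t h_{s+1} - h_s) = -(t h_{s+1} + h_s)H(-t), arranged to fit
    [conv_inv_intertwine]. Odd [n] needs only commutations, even [n] only [os_even]. *)
Lemma mixed_hyp s : ~~ odd s -> forall n,
  h n.+1 * - h s + h n * h s.+1 = - h s * alt h n.+1 + - h s.+1 * alt h n.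
Proof.
move=> s0 n; have [n1|n0] := boolP (odd n).
  rewrite (alt_odd _ n1) alt_even /= ?n1 //.
  have E1 : h n * h s.+1 = h s.+1 * h n by rewrite (os_comm hP) //= n1 s0.
  have E2 : h n.+1 * h s = h s * h n.+1.
    by rewrite (os_comm hP) //= n1 (negbTE s0).
  apply: (eq_of_subr_eq (eqrB E1 E2)); non_commutative_ring.
rewrite (alt_even _ n0) alt_odd /= ?n0 //.
apply: (eq_of_subr_eq (os_even hP n0 s0)); non_commutative_ring.
Qed.

Lemma mixed_even r s : ~~ odd r -> ~~ odd s ->
  h s.+1 * e r + e r * h s.+1 = h s * e r.+1 + e r.+1 * h s.
Proof.
move=> r0 s0.
have := conv_inv_intertwine h0 alth0 eh conv_alt_inv (mixed_hyp s0) r.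
rewrite (alt_even _ r0) alt_odd /= ?r0 // => E.
apply: (eq_of_subr_eq (esym E)); non_commutative_ring.
Qed.

(** For odd [s], H(t) commutes with h_s + t h_{s+1}, hence so does its inverse E(-t). For even [s]
    and odd [r], these are the coefficients left over by [mixed_even] after inverting
    [mixed_hyp]. *)
Lemma mixed_shift r s : odd r || odd s ->
  e r * h s.+1 - h s.+1 * e r = e r.+1 * h s - h s * e r.+1.
Proof.
have [s1 _|s0] := boolP (odd s); last rewrite orbF => r1.
  have H n : h n.+1 * h s + h n * h s.+1 = h s * h n.+1 + h s.+1 * h n.
    have [n1|n0] := boolP (odd n).
      apply: (eq_of_subr_eq (os_odd hP n1 s1)); non_commutative_ring.
    by congr (_ + _); apply: (os_comm hP); rewrite /= s1 (negbTE n0).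
  have := conv_inv_intertwine h0 h0 eh eh H r.
  have [r1|r0] := boolP (odd r).
    rewrite (alt_odd _ r1) alt_even /= ?r1 // => E.
    apply: (eq_of_subr_eq (esym E)); non_commutative_ring.
  rewrite (alt_even _ r0) alt_odd /= ?r0 // => E.
  apply: (eq_of_subr_eq E); non_commutative_ring.
have := conv_inv_intertwine h0 alth0 eh conv_alt_inv (mixed_hyp s0) r.
rewrite (alt_odd _ r1) alt_even /= ?r1 // => E.
apply: (eq_of_subr_eq E); non_commutative_ring.
Qed.

Lemma mixed_comm r s : odd r = odd s -> e r * h s = h s * e r.
Proof.
(* Two shifts give [e_q, h_{2t+2}] = [e_{q+1}, h_{2t+1}] = [e_{q+2}, h_{2t}], so [q] stays general
   in the induction on [t]. *)
have even_even t : forall q, ~~ odd q -> e q * h t.*2 = h t.*2 * e q.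
  elim: t => [|t IHt] q q0; first by rewrite h0 mulr1 mul1r.
  have E1 : odd q || odd t.*2.+1 by rewrite /= odd_double orbT.
  have E2 : odd q.+1 || odd t.*2 by rewrite /= q0.
  have q2 : ~~ odd q.+2 by rewrite /= negbK.
  apply/eqP; rewrite doubleS -subr_eq0 (mixed_shift E1) (mixed_shift E2).
  by rewrite (IHt _ q2) subrr.
case: s => [|s] rs; first by rewrite h0 mulr1 mul1r.
have [s1|s0] := boolP (odd s.+1); last first.
  by rewrite -(even_halfK s0) even_even // rs.
rewrite s1 in rs; have E : odd r || odd s by rewrite rs.
(* When both indices are odd, a single shift makes both even. *)
apply/eqP; rewrite -subr_eq0 (mixed_shift E) -(@even_halfK s) //.
by rewrite even_even ?subrr //= rs.
Qed.

(** For fixed odd [r], [mixed_shift] says that H(t) commutes with e_r - t e_{r+1}; hence so does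
    E(-t). *)
Lemma inv_shift_odd r s : odd r ->
  e s.+1 * e r + e s * e r.+1 = e r * e s.+1 + e r.+1 * e s.
Proof.
move=> r1.
have H n : h n.+1 * e r + h n * - e r.+1 = e r * h n.+1 + - e r.+1 * h n.
  have E : odd r || odd n by rewrite r1.
  apply: (eq_of_subr_eq (esym (mixed_shift E))); non_commutative_ring.
have := conv_inv_intertwine h0 h0 eh eh H s.
have [s1|s0] := boolP (odd s).
  rewrite (alt_odd _ s1) alt_even /= ?s1 // => E.
  apply: (eq_of_subr_eq E); non_commutative_ring.
rewrite (alt_even _ s0) alt_odd /= ?s0 // => E.
apply: (eq_of_subr_eq (esym E)); non_commutative_ring.
Qed.

(** For fixed even [r], the mixed relations read H(-t)(e_r + t e_{r+1}) = (e_r - t e_{r+1})H(t);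
    inverting both series gives the claim. *)
Lemma inv_shift_even r s : ~~ odd r ->
  e s.+1 * e r - e s * e r.+1 = e r * alt e s.+1 + e r.+1 * alt e s.
Proof.
move=> r0.
have H n : alt h n.+1 * e r + alt h n * e r.+1
           = e r * h n.+1 + - e r.+1 * h n.
  have [n1|n0] := boolP (odd n).
    rewrite (alt_odd _ n1) alt_even /= ?n1 // mixed_comm /= ?n1 ?(negbTE r0) //.
    by rewrite !mulNr (@mixed_comm r.+1) //= n1 r0.
  rewrite (alt_even _ n0) alt_odd /= ?n0 //.
  apply: (eq_of_subr_eq (esym (mixed_even r0 n0))); non_commutative_ring.
have := conv_inv_intertwine alth0 h0 conv_alt_inv eh H s.
by rewrite mulrN.
Qed.

Lemma inv_comm r s : odd r = odd s -> e r * e s = e s * e r.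
Proof.
have shift t q : odd q -> ~~ odd t ->
    e q * e t.+1 - e t.+1 * e q = e q.+1 * e t - e t * e q.+1.
  move=> q1 t0; have := inv_shift_even q t0.
  rewrite (alt_odd _ q1) alt_even /= ?q1 // => E.
  apply: (eq_of_subr_eq (esym E)); non_commutative_ring.
(* Here [e_q, e_{2t+2}] = -[e_{q+1}, e_{2t+1}] by [inv_shift_odd], and [shift] turns this into
   -[e_{q+2}, e_{2t}]. *)
have even_even t : forall q, ~~ odd q -> e q * e t.*2 = e t.*2 * e q.
  elim: t => [|t IHt] q q0; first by rewrite conv_inv0 mulr1 mul1r.
  have t1 : odd t.*2.+1 by rewrite /= odd_double.
  have t0 : ~~ odd t.*2 by rewrite odd_double.
  have q2 : ~~ odd q.+2 by rewrite /= negbK.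
  have := shift _ q.+1 q0 t0; rewrite (IHt _ q2) subrr => E1.
  have E := eqrB (inv_shift_odd q t1) E1.
  apply: (eq_of_subr_eq E); rewrite doubleS; non_commutative_ring.
case: s => [|s] rs; first by rewrite conv_inv0 mulr1 mul1r.
have [s1|s0] := boolP (odd s.+1); last first.
  by rewrite -(even_halfK s0) even_even // rs.
rewrite s1 in rs; apply/eqP; rewrite -subr_eq0 shift // -(@even_halfK s) //.
by rewrite even_even ?subrr //= rs.
Qed.

Lemma odd_symmetric_inv : odd_symmetric e.
Proof.
split=> [||r s r0 s0|r s r1 s1]; [exact: conv_inv0 | exact: inv_comm | |].
  have := inv_shift_even r s0; rewrite (alt_even _ r0) alt_odd /= ?r0 // => E.
  apply: (eq_of_subr_eq (esym E)); non_commutative_ring.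
apply: (eq_of_subr_eq (inv_shift_odd r s1)); non_commutative_ring.
Qed.

End OddInverse.

(** * The relations between e_1 and the even-indexed terms *)

(** The formula for the odd terms is doubled because [R] need not contain 1/2. Index 0 is allowed
    throughout, these cases being automatic from [e 0 = 1]. *)
Record even_presentation (R : pzRingType) (e : nat -> R) : Prop :=
  EvenPresentation {
    ep0 : e 0 = 1;
    ep_dbl : forall r,
      e r.*2.+1 + e r.*2.+1 = e 1 * e r.*2 + e r.*2 * e 1;
    ep_comm : forall r s, e r.*2 * e s.*2 = e s.*2 * e r.*2;
    ep_sq : forall r, e 1 * e 1 * e r.*2 = e r.*2 * (e 1 * e 1);
    ep_step : forall r, e 1 * e r.+1.*2 - e r.+1.*2 * e 1
                        = e r.*2.+1 * e 2 - e 2 * e r.*2.+1 }.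

(** [ep_dbl] is [os_even] with second index 0, and [ep_step] is [os_odd] with first index 1. [ep_sq]
    expresses that e_1 commutes with 2e_{2r+1} = e_1 e_{2r} + e_{2r} e_1. *)
Lemma even_presentation_of_odd_symmetric (R : pzRingType) (e : nat -> R) :
  odd_symmetric e -> even_presentation e.
Proof.
move=> eP.
have dbl r : e r.*2.+1 + e r.*2.+1 = e 1 * e r.*2 + e r.*2 * e 1.
  have r0 : ~~ odd r.*2 by rewrite odd_double.
  have := os_even eP r0 (isT : ~~ odd 0); rewrite (os0 eP) => E.
  apply: (eq_of_subr_eq (esym E)); non_commutative_ring.
split=> [|//|r s|r|r]; first exact: (os0 eP).
- by apply: (os_comm eP); rewrite !odd_double.
- have E : e 1 * e r.*2.+1 = e r.*2.+1 * e 1.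
    by apply: (os_comm eP); rewrite /= odd_double.
  have : e 1 * (e r.*2.+1 + e r.*2.+1) = (e r.*2.+1 + e r.*2.+1) * e 1.
    by rewrite mulrDl mulrDr E.
  rewrite dbl => {}E; apply: (eq_of_subr_eq E); non_commutative_ring.
- have r1 : odd r.*2.+1 by rewrite /= odd_double.
  exact: (os_odd eP (isT : odd 1) r1).
Qed.

Section EvenPresentation.
Variables (R : pzRingType) (e : nat -> R).
Hypothesis two_inj : forall x : R, x + x = 0 -> x = 0.
Hypothesis eP : even_presentation e.

Let o := e 1.
Let x r := e r.*2.
Let y r := e r.*2.+1.

Let dbl_inj (a b : R) : a + a = b + b -> a = b.
Proof.
move=> E; apply/eqP; rewrite -subr_eq0; apply/eqP; apply: two_inj.
by rewrite addrACA -opprD E subrr.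
Qed.

Let y2 r : y r + y r = o * x r + x r * o := ep_dbl eP r.
Let xC r s : x r * x s = x s * x r := ep_comm eP r s.

(** Twice the commutator is [o, o x_r + x_r o] = [o^2, x_r]. *)
Lemma ep_odd_comm1 r : o * y r = y r * o.
Proof.
apply: dbl_inj; rewrite -mulrDr -mulrDl y2.
apply: (eq_of_subr_eq (ep_sq eP r)); rewrite -/o -/(x r); non_commutative_ring.
Qed.

(** Twice the left side is x_a o x_b + x_b o x_a + x_a x_b o + o x_b x_a, which is symmetric because
    x_a and x_b commute. *)
Lemma ep_anticomm a b : x a * y b + y b * x a = x b * y a + y a * x b.
Proof.
have E c d : x c * y d + y d * x c + (x c * y d + y d * x c)
             = x c * (o * x d + x d * o) + (o * x d + x d * o) * x c.
  by rewrite -y2; non_commutative_ring.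
apply: dbl_inj; rewrite !E.
apply: (eq_of_subr_eq (eqrB (congr1 ( *%R^~ o) (xC a b))
                               (congr1 ( *%R o) (xC a b)))).
non_commutative_ring.
Qed.

(* With z = [o, x_1], four times the commutator is
   z x_b x_a + x_b z x_a + x_a z x_b + x_a x_b z. *)
Lemma ep_commutator a b :
  y a * x b.+1 - x b.+1 * y a = y b * x a.+1 - x a.+1 * y b.
Proof.
pose z := o * x 1 - x 1 * o.
pose P c d := y c * x d.+1 - x d.+1 * y c.
(* As [x c] and [x d.+1] commute, 2[y_c, x_{d+1}] is the anticommutator of x_c with [o, x_{d+1}],
   and [ep_step] replaces the latter by [y_d, x_1]. *)
have E c d : P c d + P c d
    = (y d * x 1 - x 1 * y d) * x c + x c * (y d * x 1 - x 1 * y d).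
  have -> : P c d + P c d = (y c + y c) * x d.+1 - x d.+1 * (y c + y c).
    by rewrite /P; non_commutative_ring.
  rewrite -(ep_step eP d) -/o -/(x d.+1) y2.
  have F := xC c d.+1.
  apply: (eq_of_subr_eq (eqrD (congr1 ( *%R o) F) (congr1 ( *%R^~ o) F))).
  non_commutative_ring.
have E1 d : (y d * x 1 - x 1 * y d) + (y d * x 1 - x 1 * y d) = z * x d + x d * z.
  have -> : (y d * x 1 - x 1 * y d) + (y d * x 1 - x 1 * y d)
            = (y d + y d) * x 1 - x 1 * (y d + y d).
    by non_commutative_ring.
  rewrite y2 /z; have F := xC d 1.
  apply: (eq_of_subr_eq (eqrD (congr1 ( *%R o) F) (congr1 ( *%R^~ o) F))).
  non_commutative_ring.
have E2 c d : P c d + P c d + (P c d + P c d)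
    = (z * x d + x d * z) * x c + x c * (z * x d + x d * z).
  by rewrite !E -E1; non_commutative_ring.
apply: dbl_inj; apply: dbl_inj; rewrite -/(P a b) -/(P b a) !E2.
have F := xC a b.
apply: (eq_of_subr_eq (eqrB (congr1 ( *%R^~ z) F) (congr1 ( *%R z) F))).
non_commutative_ring.
Qed.

Lemma ep_odd_comm a b : y a * y b = y b * y a.
Proof.
pose G c d := y c * y d - y d * y c.
(* Expand 2 y_{d+1} and move [o] out of the commutator, since [o] commutes with [y c]. *)
have E c d : G c d.+1 + G c d.+1
    = o * (y c * x d.+1 - x d.+1 * y c) + (y c * x d.+1 - x d.+1 * y c) * o.
  have -> : G c d.+1 + G c d.+1
            = y c * (y d.+1 + y d.+1) - (y d.+1 + y d.+1) * y c.
    by rewrite /G; non_commutative_ring.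
  rewrite y2; have F := esym (ep_odd_comm1 c).
  apply: (eq_of_subr_eq (eqrD (congr1 ( *%R (x d.+1)) F)
    (congr1 ( *%R^~ (x d.+1)) F))).
  non_commutative_ring.
have S c d : G c d.+1 = G d c.+1 by apply: dbl_inj; rewrite !E ep_commutator.
suff: G a b = 0 by move/eqP; rewrite subr_eq0 => /eqP.
elim: a b => [|a IHa] b; first by rewrite /G ep_odd_comm1 subrr.
(* The chain is G(a+1, b) = -G(b, a+1) = -G(a, b+1), which is why [b] is general in the
   induction. *)
have -> : G a.+1 b = - G b a.+1 by rewrite /G opprB.
by rewrite S IHa oppr0.
Qed.

Lemma odd_symmetric_of_even_presentation : odd_symmetric e.
Proof.
have evE n : ~~ odd n -> e n = x n./2 by move=> n0; rewrite /x even_halfK.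
have odE n : odd n -> e n = y n./2.
  by move=> n1; rewrite /y -{1}(odd_double_half n) n1.
split=> [|r s rs|r s r0 s0|r s r1 s1]; first exact: (ep0 eP).
- have [s1|s0] := boolP (odd s).
    by rewrite !odE ?rs // ep_odd_comm.
  by rewrite !evE ?rs // xC.
- rewrite (evE r) // (evE s) // (odE r.+1) // (odE s.+1) //=.
  by rewrite !uphalf_half (negbTE r0) (negbTE s0) ep_anticomm.
- have r2 : ~~ odd r.+1 by rewrite /= r1.
  have s2 : ~~ odd s.+1 by rewrite /= s1.
  rewrite (odE r) // (odE s) // (evE r.+1) // (evE s.+1) //=.
  by rewrite !uphalf_half r1 s1 ep_commutator.
Qed.

End EvenPresentation.

(** * The quotient of the free algebra by a two-sided ideal *)

Section Ideal.
Variables (k : fieldType) (S : FreeAlg k -> Prop).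

Lemma in_ideal0 : in_ideal S 0.
Proof. by exists [::]; split=> //; rewrite big_nil. Qed.

Lemma in_idealD p q : in_ideal S p -> in_ideal S q -> in_ideal S (p + q).
Proof.
move=> [l [Sl ->]] [l' [Sl' ->]]; exists (l ++ l'); split; last by rewrite big_cat.
by move=> t; rewrite mem_cat => /orP[/Sl|/Sl'].
Qed.

Lemma in_idealMl a p : in_ideal S p -> in_ideal S (a * p).
Proof.
move=> [l [Sl ->]]; exists [seq (a * t.1.1, t.1.2, t.2) | t <- l]; split.
  by move=> _ /mapP[t /Sl St ->].
by rewrite big_map mulr_sumr; apply: eq_bigr => t _; rewrite !mulrA.
Qed.

Lemma in_idealMr a p : in_ideal S p -> in_ideal S (p * a).
Proof.
move=> [l [Sl ->]]; exists [seq (t.1.1, t.1.2, t.2 * a) | t <- l]; split.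
  by move=> _ /mapP[t /Sl St ->].
rewrite mulr_suml big_map; apply: eq_bigr => t _; rewrite -mulrA; reflexivity.
Qed.

Lemma in_idealN p : in_ideal S p -> in_ideal S (- p).
Proof. by rewrite -mulN1r; exact: in_idealMl. Qed.

Lemma in_idealB p q : in_ideal S p -> in_ideal S q -> in_ideal S (p - q).
Proof. by move=> Ip Iq; apply: in_idealD => //; exact: in_idealN. Qed.

Lemma in_ideal_gen p : S p -> in_ideal S p.
Proof.
move=> Sp; exists [:: (1, p, 1)]; split; first by move=> t; rewrite inE => /eqP ->.
by rewrite big_seq1 mul1r mulr1.
Qed.

(** The quotient construction takes a boolean predicate; membership is made boolean classically. *)
Definition idealp : {pred FreeAlg k} := fun p => boolp.asbool (in_ideal S p).

Lemma idealpP p : reflect (in_ideal S p) (p \in idealp).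
Proof. exact: boolp.asboolP. Qed.

Lemma idealp_zmod_closed : zmod_closed idealp.
Proof.
split=> [|p q /idealpP Ip /idealpP Iq]; apply/idealpP; first exact: in_ideal0.
exact: in_idealB.
Qed.

HB.instance Definition _ :=
  GRing.isZmodClosed.Build (FreeAlg k) idealp idealp_zmod_closed.

Definition presented : Type := Quotient.quot idealp.
HB.instance Definition _ := GRing.Zmodule.on presented.

Definition pr (p : FreeAlg k) : presented := (\pi_(Quotient.quot idealp) p)%qT.

Lemma prB : {morph pr : p q / p - q}.
Proof. by move=> p q; rewrite /pr !piE. Qed.

Lemma pr_eq p q : pr p = pr q <-> in_ideal S (p - q).
Proof.
rewrite /pr; split=> [/eqP|Ipq]; first by rewrite -Quotient.idealrBE => /idealpP.
by apply/eqP; rewrite -Quotient.idealrBE; apply/idealpP.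
Qed.

Lemma reprK_pr (u : presented) : pr (repr (u : Quotient.quot idealp)) = u.
Proof. exact: reprK. Qed.

Definition presented_one : presented := pr 1.
(** The product is taken on chosen representatives; [pr_mul] shows that its class does not depend on
    them. *)
Definition presented_mul (u v : presented) : presented :=
  pr (repr (u : Quotient.quot idealp) * repr (v : Quotient.quot idealp)).

Lemma pr_mul p q : pr (p * q) = presented_mul (pr p) (pr q).
Proof.
apply/pr_eq; set p' := repr _; set q' := repr _.
have -> : p * q - p' * q' = (p - p') * q + p' * (q - q').
  by rewrite mulrBl mulrBr addrA subrK.
apply: in_idealD; [apply: in_idealMr | apply: in_idealMl];
  by apply/pr_eq; rewrite reprK_pr.
Qed.

Lemma presented_mulA : associative presented_mul.
Proof.
move=> u v w; rewrite -(reprK_pr u) -(reprK_pr v) -(reprK_pr w).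
by rewrite -!pr_mul mulrA.
Qed.

Lemma presented_mul1l : left_id presented_one presented_mul.
Proof. by move=> u; rewrite -(reprK_pr u) -pr_mul mul1r. Qed.

Lemma presented_mul1r : right_id presented_one presented_mul.
Proof. by move=> u; rewrite -(reprK_pr u) -pr_mul mulr1. Qed.

HB.instance Definition _ :=
  GRing.isZmodMorphism.Build (FreeAlg k) presented pr prB.

Lemma presented_mulDl : left_distributive presented_mul +%R.
Proof.
move=> u v w; rewrite -(reprK_pr u) -(reprK_pr v) -(reprK_pr w).
by rewrite -raddfD -!pr_mul mulrDl raddfD.
Qed.

Lemma presented_mulDr : right_distributive presented_mul +%R.
Proof.
move=> u v w; rewrite -(reprK_pr u) -(reprK_pr v) -(reprK_pr w).
by rewrite -raddfD -!pr_mul mulrDr raddfD.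
Qed.

HB.instance Definition _ := GRing.Zmodule_isPzRing.Build presented
  presented_mulA presented_mul1l presented_mul1r presented_mulDl presented_mulDr.

Lemma pr_is_monoid_morphism : monoid_morphism pr.
Proof. by split=> [|p q]; [exact: erefl | exact: pr_mul]. Qed.

HB.instance Definition _ :=
  GRing.isMonoidMorphism.Build (FreeAlg k) presented pr pr_is_monoid_morphism.

Lemma pr_eq0 p : pr p = 0 <-> in_ideal S p.
Proof. by rewrite -(rmorph0 pr) pr_eq subr0. Qed.

End Ideal.

(** * Evaluation homomorphisms of the free algebra *)

(** Centrality of scalars is what makes evaluation at noncommuting values multiplicative. *)
Lemma malgC_comm (K : monomType) (R : comNzRingType) (c : R)
  (p : {malg R[K]}) : GRing.comm c%:MP%R p.
Proof.
rewrite /GRing.comm !malgM_def fgmulUg fgmulgU; apply: eq_bigr => m _.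
by rewrite mulrC mul1m mulm1.
Qed.

Section Evaluation.
Variable k : fieldType.
Implicit Types (g : nat -> FreeAlg k) (p q : FreeAlg k).

(** This has the shape of [phi] with arbitrary images of the letters, so [phi] is convertible to
    [ev (imgX k)]. *)
Definition ev g q : FreeAlg k :=
  \sum_(m <- msupp q) q@_m *: \prod_(i <- fmonom_val m) g i.

Definition monom_ev g (m : fmonom nat) : FreeAlg k :=
  \prod_(i <- fmonom_val m) g i.

Lemma monom_ev_mmorphism g : mmorphism (monom_ev g).
Proof.
rewrite /monom_ev; split=> [m1 m2|]; last by rewrite fm1 big_nil.
by rewrite fmM big_cat.
Qed.

HB.instance Definition _ g :=
  monalg.isMultiplicative.Build (fmonom nat) (FreeAlg k) (monom_ev g)
    (monom_ev_mmorphism g).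

Lemma evE g : ev g =1 mmap (@malgC (fmonom nat) k) (monom_ev g).
Proof. by move=> q; apply: eq_bigr => m _; rewrite mul_malgC. Qed.

Lemma ev_is_zmod_morphism g : zmod_morphism (ev g).
Proof. by move=> p q; rewrite !evE raddfB. Qed.

HB.instance Definition _ g :=
  GRing.isZmodMorphism.Build (FreeAlg k) (FreeAlg k) (ev g)
    (ev_is_zmod_morphism g).

Lemma ev_is_monoid_morphism g : monoid_morphism (ev g).
Proof.
have [|mm m1] := @commr_mmap_is_multiplicative _ _ _
  (@malgC (fmonom nat) k) (monom_ev g).
  by move=> q m m'; apply: malgC_comm.
by split=> [|p q]; rewrite !evE; [apply: m1 | apply: mm].
Qed.

HB.instance Definition _ g :=
  GRing.isMonoidMorphism.Build (FreeAlg k) (FreeAlg k) (ev g)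
    (ev_is_monoid_morphism g).

Lemma evZ g (c : k) p : ev g (c *: p) = c *: ev g p.
Proof. by rewrite !evE mmapZ mul_malgC. Qed.

Lemma ev_gen g i : ev g (gen k i) = g i.
Proof.
by rewrite evE mmapU mul1r /monom_ev fmuE big_seq1.
Qed.

Lemma ev_id : ev (gen k) =1 id.
Proof.
move=> p; rewrite [RHS]monalgE; apply: eq_bigr => m _.
suff -> : \prod_(i <- fmonom_val m) gen k i = << m >>.
  apply/malgP => n; rewrite mcoeffZ 2!mcoeffU mulrnAr mulr1; reflexivity.
case: m => s /=; rewrite -(fmE s); elim: s => [|i s IHs].
  by rewrite big_nil; congr << _ >>; apply: val_inj; rewrite /= fm1 fmE.
rewrite big_cons IHs malgM_def fgmulUU mulr1; congr << _ >>.
by apply: val_inj; rewrite /= fmM fmuE !fmE.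
Qed.

Lemma ev_comp g g' : ev g \o ev g' =1 ev (ev g \o g').
Proof.
move=> p /=; rewrite {2}/ev raddf_sum; apply: eq_bigr => m _.
by rewrite /= evZ rmorph_prod.
Qed.

Lemma pr_ev (S : FreeAlg k -> Prop) g g' :
  (forall i, pr S (g i) = pr S (g' i)) -> forall p, pr S (ev g p) = pr S (ev g' p).
Proof.
move=> gg' p.
have E f : pr S (ev f p) = \sum_(m <- msupp p)
    pr S (p@_m)%:MP * \prod_(i <- fmonom_val m) pr S (f i).
  rewrite /ev (raddf_sum (pr S)); apply: eq_bigr => m _ /=.
  by rewrite -mul_malgC (rmorphM (pr S)) (rmorph_prod (pr S)).
rewrite (E g) (E g'); apply: eq_bigr => m _; congr (_ * _).
by apply: eq_bigr => i _; exact: gg'.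
Qed.

End Evaluation.

Lemma rmorph_in_ideal (k : fieldType) (R : pzRingType)
    (f : {rmorphism FreeAlg k -> R}) (S : FreeAlg k -> Prop) :
  (forall p, S p -> f p = 0) -> forall p, in_ideal S p -> f p = 0.
Proof.
move=> fS _ [l [Sl ->]]; rewrite rmorph_sum big_seq big1 // => t /Sl /fS.
by rewrite !rmorphM => ->; rewrite mulr0 mul0r.
Qed.

(** A representative [p] is the constant 1/2 times [p + p], so it lies in the ideal as soon as
    [p + p] does. *)
Lemma presented_two_inj (k : fieldType) (S : FreeAlg k -> Prop) :
  (2%:R : k) != 0 -> forall u : presented S, u + u = 0 -> u = 0.
Proof.
move=> two0 u; rewrite -(reprK_pr u) -raddfD => /pr_eq0 Iu; apply/pr_eq0.
set p := repr _ in Iu *.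
have -> : p = (2%:R^-1 : k)%:MP * (p + p).
  by rewrite mul_malgC -mulr2n -scaler_nat scalerA mulVf // scale1r.
exact: in_idealMl.
Qed.

(** * The series inverse to a given one *)

(** The recursion of [elist] over an arbitrary sequence: it yields the e's from the h's, and also
    candidates for the h's from [eX]. *)
Fixpoint inv_list (R : pzRingType) (a : nat -> R) (n : nat) : seq R :=
  if n is n'.+1 then
    let l := inv_list a n' in
    rcons l ((-1) ^+ n'.+2 *
             \sum_(s < n'.+1) (-1) ^+ s * (l`_s * a (n'.+1 - s)%N))
  else [:: 1].

Definition inv_seq (R : pzRingType) (a : nat -> R) (n : nat) : R :=
  (inv_list a n)`_n.

Lemma elistE (k : fieldType) n : elist k n = inv_list (hH k) n.
Proof.
elim: n => [|n IHn]; first reflexivity.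
rewrite /= IHn; reflexivity.
Qed.

Lemma eHE (k : fieldType) : eH k =1 inv_seq (hH k).
Proof. by move=> n; rewrite /eH elistE. Qed.

Section InverseSequence.
Variables (R : pzRingType) (a : nat -> R).

Lemma size_inv_list n : size (inv_list a n) = n.+1.
Proof. by elim: n => //= n IHn; rewrite size_rcons IHn. Qed.

Lemma nth_inv_list n i : (i <= n)%N -> (inv_list a n)`_i = inv_seq a i.
Proof.
elim: n => [|n IHn]; first by rewrite leqn0 => /eqP ->.
rewrite leq_eqVlt ltnS => /predU1P[-> //|le_in].
by rewrite /= nth_rcons size_inv_list ltnS le_in IHn.
Qed.

Lemma conv_inv_seq : a 0 = 1 -> conv (alt (inv_seq a)) a =1 conv1 R.
Proof.
move=> a0 [|n]; first by rewrite conv_at0 a0 mulr1 /alt mul1r.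
rewrite /conv big_ord_recr /= subnn a0 mulr1.
pose T := \sum_(s < n.+1) alt (inv_seq a) s * a (n.+1 - s)%N.
(* The signs (-1)^(n+1) and (-1)^(n+2) multiply to -1. *)
have -> : alt (inv_seq a) n.+1 = - T.
  rewrite /alt /inv_seq /= nth_rcons size_inv_list ltnn eqxx mulrA -exprD.
  rewrite -signr_odd addnS oddS addnn odd_double expr1 mulN1r; congr (- _).
  by apply: eq_bigr => s _; rewrite mulrA nth_inv_list // -ltnS.
by rewrite -/T subrr.
Qed.

End InverseSequence.

Lemma rmorph_conv (R R' : pzRingType) (f : {rmorphism R -> R'}) (a b : nat -> R) n :
  f (conv a b n) = conv (f \o a) (f \o b) n.
Proof. by rewrite rmorph_sum; apply: eq_bigr => i _; rewrite rmorphM. Qed.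

Lemma rmorph_alt (R R' : pzRingType) (f : {rmorphism R -> R'}) (a : nat -> R) :
  f \o alt a =1 alt (f \o a).
Proof. by move=> n /=; rewrite /alt rmorphM rmorphXn rmorphN1. Qed.

Lemma rmorph_conv_inv (R R' : pzRingType) (f : {rmorphism R -> R'})
    (a b : nat -> R) :
  conv (alt b) a =1 conv1 R -> conv (alt (f \o b)) (f \o a) =1 conv1 R'.
Proof.
move=> ba n; rewrite -(eq_conv (rmorph_alt f b) (frefl _)) -rmorph_conv ba.
exact: rmorph_nat.
Qed.

(** Swap the factors of E(-t)H(t) = 1, then substitute -t for t. *)
Lemma conv_alt_inv_sym (R : pzRingType) (a b : nat -> R) : a 0 = 1 ->
  conv (alt b) a =1 conv1 R -> conv (alt a) b =1 conv1 R.
Proof.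
move=> a0 ba n.
have b0 : alt b 0 = 1 by have := ba 0; rewrite conv_at0 a0 mulr1.
rewrite -(eq_conv (frefl _) (altK b)) conv_alt /alt (conv_inv_sym b0 ba).
exact: alt_conv1.
Qed.

Lemma conv_alt_inv_uniq (R : pzRingType) (a b b' : nat -> R) : a 0 = 1 ->
  conv (alt b) a =1 conv1 R -> conv (alt b') a =1 conv1 R -> b =1 b'.
Proof.
move=> a0 ba b'a n; rewrite -(altK b) -(altK b') /alt.
by have := conv_inv_uniq a0 ba b'a n; rewrite /alt => ->.
Qed.

(** * The two presentations *)

Section RingMorphism.
Variables (A R : pzRingType) (f : {rmorphism A -> R}).

Lemma rmorph_commutator (a b : A) : f (a * b - b * a) = f a * f b - f b * f a.
Proof. by rewrite rmorphB !rmorphM. Qed.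

Lemma rmorph_odd_relation (n : nat) (a b c d : A) :
  f (a * b + (-1) ^+ n * (b * a) - ((-1) ^+ n * (c * d) + d * c))
  = f a * f b + (-1) ^+ n * (f b * f a)
    - ((-1) ^+ n * (f c * f d) + f d * f c).
Proof. by rewrite rmorphB !rmorphD !rmorphM rmorphXn rmorphN1. Qed.

Lemma rmorph_dbl (a b c : A) :
  a + a = b * c + c * b -> f a + f a = f b * f c + f c * f b.
Proof. by rewrite -rmorphD => ->; rewrite rmorphD !rmorphM. Qed.

End RingMorphism.

Lemma rmorph_comm (A : nzRingType) (R : pzRingType) (f : {rmorphism A -> R})
    (a b : A) :
  f (Defs.comm a b) = f a * f b - f b * f a.
Proof. exact: rmorph_commutator. Qed.

Lemma rmorph_commB (A : nzRingType) (R : pzRingType) (f : {rmorphism A -> R})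
    (a b c d : A) :
  f (Defs.comm a b - Defs.comm c d)
  = f a * f b - f b * f a - (f c * f d - f d * f c).
Proof. by rewrite rmorphB !rmorph_comm. Qed.

Lemma rmorph_comm_sq (A : nzRingType) (R : pzRingType) (f : {rmorphism A -> R})
    (a b : A) :
  f (Defs.comm (a * a) b) = f a * f a * f b - f b * (f a * f a).
Proof. by rewrite rmorph_comm rmorphM. Qed.

(** The universal property of OSym. It turns every question about ideal membership of relations into
    one about sequences in the target. *)
Lemma odd_symmetricP (k : fieldType) (R : pzRingType)
    (f : {rmorphism FreeAlg k -> R}) :
  (forall p, relOSym p -> f p = 0) <-> odd_symmetric (f \o hH k).
Proof.
have f1 : f (hH k 0) = 1 by exact: rmorph1.
split=> [f0|fP p [r [[|s] [// _]]]].
  have rel r s : odd r <> odd s.+1 ->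
      f (hH k r) * f (hH k s.+1) + (-1) ^+ r * (f (hH k s.+1) * f (hH k r))
      - ((-1) ^+ r * (f (hH k r.+1) * f (hH k s))
         + f (hH k s) * f (hH k r.+1)) = 0.
    move=> rs; rewrite -rmorph_odd_relation; apply: f0.
    by exists r, s.+1; split=> //; right; split.
  split=> [|r s rs|r s r0 s0|r s r1 s1]; first exact: f1.
  - case: s rs => [|s] rs; first by rewrite [(f \o _) 0]f1 mulr1 mul1r.
    apply/eqP; rewrite -subr_eq0 -[X in X == 0]rmorph_commutator f0 //.
    by exists r, s.+1; split=> //; left.
  - have /rel : odd r <> odd s.+1 by rewrite /= (negbTE r0) (negbTE s0).
    rewrite -signr_odd (negbTE r0) expr0 => E.
    apply: (eq_of_subr_eq E) => /=; non_commutative_ring.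
  - have /rel : odd r <> odd s.+1 by rewrite /= r1 s1.
    rewrite -signr_odd r1 expr1 => E.
    apply: (eq_of_subr_eq E) => /=; non_commutative_ring.
case=> [[rs ->]|[rs ->]].
  rewrite rmorph_commutator; apply/eqP; rewrite subr_eq0; apply/eqP.
  exact: (os_comm fP rs).
rewrite rmorph_odd_relation -signr_odd.
have [r1|r0] := boolP (odd r).
  have s1 : odd s by move: rs; rewrite r1 /=; case: (odd s).
  apply: (eq_of_subr_eq (os_odd fP r1 s1)) => /=; rewrite expr1.
  non_commutative_ring.
have s0 : ~~ odd s by move: rs; rewrite (negbTE r0) /=; case: (odd s).
apply: (eq_of_subr_eq (os_even fP r0 s0)) => /=; rewrite expr0.
non_commutative_ring.
Qed.

(** Letter 0 already encodes [o], so e_0 = 1 has to be put in separately. *)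
Definition evenX (k : fieldType) (r : nat) : FreeAlg k :=
  if r is 0 then 1 else gen k r.

(* The odd terms are forced by 2 e_(2r+1) = o e_(2r) + e_(2r) o. *)
Definition eX (k : fieldType) (n : nat) : FreeAlg k :=
  if odd n then 2%:R^-1 *: (oX k * evenX k n./2 + evenX k n./2 * oX k)
  else evenX k n./2.

Section NewPresentation.
Variable k : fieldType.
Hypothesis two0 : (2%:R : k) != 0.

Lemma half_dbl (V : lmodType k) (v : V) : 2%:R^-1 *: v + 2%:R^-1 *: v = v.
Proof. by rewrite -scalerDl -mulr2n -[_ *+ 2]mulr_natl mulfV // scale1r. Qed.

Lemma eX_even r : eX k r.*2 = evenX k r.
Proof. by rewrite /eX odd_double doubleK. Qed.

Lemma eX_odd r :
  eX k r.*2.+1 = 2%:R^-1 *: (oX k * evenX k r + evenX k r * oX k).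
Proof. by rewrite /eX /= odd_double uphalf_double. Qed.

Lemma eX1 : eX k 1 = oX k.
Proof. by rewrite (eX_odd 0) mulr1 mul1r scalerDr half_dbl. Qed.

Lemma eX_dbl r :
  eX k r.*2.+1 + eX k r.*2.+1 = eX k 1 * eX k r.*2 + eX k r.*2 * eX k 1.
Proof. by rewrite eX1 eX_even eX_odd half_dbl. Qed.

(** The counterpart of [odd_symmetricP]. [ep_dbl] already holds in the free algebra by the choice of
    [eX], and index 0 is settled by e_0 = 1. *)
Lemma even_presentationP (R : pzRingType) (f : {rmorphism FreeAlg k -> R}) :
  (forall p, relNew p -> f p = 0) <-> even_presentation (f \o eX k).
Proof.
have F0 : f (eX k 0) = 1 by rewrite (eX_even 0); exact: rmorph1.
have F1 : f (eX k 1) = f (oX k) by rewrite eX1.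
have FS r : f (eX k r.+1.*2) = f (EX k r.+1) by rewrite eX_even.
have FO r : f (eX k r.+1.*2.+1)
    = f (2%:R^-1 *: (oX k * EX k r.+1 + EX k r.+1 * oX k)) by rewrite eX_odd.
split=> [f0|fP p [[|r] [[|s] [// _ [// _]]]]].
  split=> [|r|r s|r|r] /=.
  - exact: F0.
  - exact: rmorph_dbl (eX_dbl r).
  - case: r s => [|r] [|s]; rewrite ?double0 ?F0 ?mulr1 ?mul1r; try reflexivity.
    rewrite !FS; apply/eqP; rewrite -subr_eq0 -rmorph_comm f0; first exact: eqxx.
    by exists r.+1, s.+1; do 2!split=> //; left.
  - case: r => [|r]; first by rewrite double0 F0 mulr1 mul1r.
    rewrite FS F1; apply/eqP; rewrite -subr_eq0 -rmorph_comm_sq f0.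
      exact: eqxx.
    by exists r.+1, 1%N; do 2!split=> //; right; left.
  - case: r => [|r]; first by rewrite double0.
    rewrite F1 FO FS (FS 0); apply/eqP; rewrite -subr_eq0 -rmorph_commB f0.
      exact: eqxx.
    by exists r.+1, 1%N; do 2!split=> //; right; right.
case=> [->|[->|->]].
- have E := ep_comm fP r.+1 s.+1; rewrite /= !FS in E.
  by rewrite rmorph_comm E subrr.
- have E := ep_sq fP r.+1; rewrite /= F1 FS in E.
  by rewrite rmorph_comm_sq E subrr.
- have E := ep_step fP r.+1; rewrite /= F1 FO FS (FS 0) in E.
  by rewrite rmorph_commB E subrr.
Qed.

End NewPresentation.

(** * The two mutually inverse homomorphisms *)

Section Isomorphism.
Variable k : fieldType.
Hypothesis two0 : (2%:R : k) != 0.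

(** The elements h_n expressed in the new generators. *)
Let hX := inv_seq (eX k).
Let phi' : {rmorphism FreeAlg k -> FreeAlg k} := ev (imgX k).
(** The candidate inverse of [phi]; the successor appears because letter [i] encodes h_{i+1}. *)
Let psi : {rmorphism FreeAlg k -> FreeAlg k} := ev (fun i => hX i.+1).

Let eX0 : eX k 0 = 1. Proof. exact: eX_even 0. Qed.

Let hH_eH : conv (alt (eH k)) (hH k) =1 conv1 (FreeAlg k).
Proof.
move=> n; rewrite -(@conv_inv_seq _ (hH k) erefl).
by apply: eq_conv; first by move=> i; rewrite /alt eHE.
Qed.

Let eX_hX : conv (alt hX) (eX k) =1 conv1 (FreeAlg k).
Proof. exact: conv_inv_seq. Qed.

Lemma ev_imgX_evenX r : ev (imgX k) (evenX k r) = eH k r.*2.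
Proof.
case: r => [|r]; first exact: rmorph1.
by rewrite [LHS]ev_gen /imgX mul2n.
Qed.

Lemma ev_imgX_oX : ev (imgX k) (oX k) = eH k 1.
Proof. exact: ev_gen. Qed.

Section Target.
Variables (R : pzRingType) (f : {rmorphism FreeAlg k -> R}).
Hypothesis two_inj : forall x : R, x + x = 0 -> x = 0.

(** Even terms match already in the free algebra. Odd terms match only after [f], where both doubles
    equal the anticommutator of e_1 with an even term. *)
Lemma ev_imgX_eX n : odd_symmetric (f \o eH k) ->
  f (ev (imgX k) (eX k n)) = f (eH k n).
Proof.
move=> /even_presentation_of_odd_symmetric eP.
rewrite -(odd_double_half n); case: odd; last first.
  by rewrite add0n eX_even ev_imgX_evenX.
rewrite add1n; set r := n./2; apply/eqP; rewrite -subr_eq0; apply/eqP/two_inj.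
rewrite addrACA -opprD (ep_dbl eP r) /=.
have := rmorph_dbl (f \o phi') (eX_dbl two0 r).
rewrite /= eX1 // eX_even ev_imgX_evenX ev_imgX_oX => ->.
exact: subrr.
Qed.

End Target.

Let RH := presented (@relOSym k).
Let RN := presented (@relNew k).
Let piH : {rmorphism FreeAlg k -> RH} := pr (@relOSym k).
Let piN : {rmorphism FreeAlg k -> RN} := pr (@relNew k).

Lemma odd_symmetric_hH : odd_symmetric (piH \o hH k).
Proof. by apply/odd_symmetricP => p Sp; apply/pr_eq0/in_ideal_gen. Qed.

Lemma odd_symmetric_eH : odd_symmetric (piH \o eH k).
Proof. exact: odd_symmetric_inv odd_symmetric_hH (rmorph_conv_inv _ hH_eH). Qed.

Lemma phi_eX n : piH (phi' (eX k n)) = piH (eH k n).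
Proof. exact: ev_imgX_eX (presented_two_inj two0) n odd_symmetric_eH. Qed.

Lemma even_presentation_phi_eX : even_presentation (piH \o phi' \o eX k).
Proof.
have -> : piH \o phi' \o eX k = piH \o eH k by apply: boolp.funext; exact: phi_eX.
exact: even_presentation_of_odd_symmetric odd_symmetric_eH.
Qed.

Lemma phi_relNew q : in_ideal (@relNew k) q -> in_ideal (@relOSym k) (phi' q).
Proof.
move=> Iq; apply/pr_eq0; rewrite -[LHS]/((piH \o phi') q).
apply: rmorph_in_ideal Iq => p.
exact: (even_presentationP two0 (piH \o phi')).2 even_presentation_phi_eX p.
Qed.

Lemma psi_hH n : psi (hH k n) = hX n.
Proof.
by case: n => [|n]; rewrite /psi /= ?rmorph1 ?ev_gen // /hX /inv_seq.
Qed.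

(** Modulo the new relations [eX] is odd symmetric, and this passes to the inverse series. *)
Lemma odd_symmetric_hX : odd_symmetric (piN \o hX).
Proof.
have eP : even_presentation (piN \o eX k).
  by apply/even_presentationP => // p Sp; apply/pr_eq0/in_ideal_gen.
have eO := odd_symmetric_of_even_presentation (presented_two_inj two0) eP.
exact: odd_symmetric_inv eO (rmorph_conv_inv _ eX_hX).
Qed.

Lemma psi_relOSym p : in_ideal (@relOSym k) p -> in_ideal (@relNew k) (psi p).
Proof.
move=> Ip; apply/pr_eq0; rewrite -[LHS]/((piN \o psi) p).
apply: rmorph_in_ideal Ip; apply/odd_symmetricP.
have -> : (piN \o psi) \o hH k = piN \o hX.
  by apply: boolp.funext => n /=; rewrite psi_hH.
exact: odd_symmetric_hX.
Qed.

(** Both sequences are inverse to [hX] up to signs, and inverses are unique. No relation is used, so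
    the equality holds in the free algebra itself. *)
Lemma psi_eH n : psi (eH k n) = eX k n.
Proof.
have hX0 : hX 0 = 1 by [].
have E : conv (alt (psi \o eH k)) hX =1 conv1 (FreeAlg k).
  move=> m; rewrite -(rmorph_conv_inv psi hH_eH m).
  apply: eq_conv => i; first reflexivity.
  by rewrite [RHS]psi_hH.
exact: (conv_alt_inv_uniq hX0 E (conv_alt_inv_sym eX0 eX_hX) n).
Qed.

Lemma psi_phi q : psi (phi' q) = q.
Proof.
rewrite -[LHS]/((psi \o phi') q) ev_comp -[RHS]ev_id.
have -> // : psi \o imgX k = gen k.
apply: boolp.funext => -[|i] /=; rewrite -/psi psi_eH ?eX1 //.
by rewrite mul2n eX_even.
Qed.

(** It suffices to compare letters: modulo the OSym relations, the images of [hX] under [phi'] and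
    the h's are both inverse, up to signs, to the e's. *)
Lemma phi_psi p : piH (phi' (psi p)) = piH p.
Proof.
rewrite -[phi' _]/((phi' \o psi) p) ev_comp -[in RHS](ev_id p).
apply: pr_ev => i /=; rewrite -[gen k i]/(hH k i.+1).
have h0 : (piH \o eH k) 0 = 1 by exact: rmorph1.
apply: (conv_alt_inv_uniq (b := (piH \o phi') \o hX) (b' := piH \o hH k) h0).
  move=> n; rewrite -(rmorph_conv_inv (piH \o phi') eX_hX).
  by apply: eq_conv => // j; rewrite /= phi_eX.
apply: conv_alt_inv_sym; first exact: rmorph1.
exact: rmorph_conv_inv hH_eH.
Qed.

End Isomorphism.

(* OSym = FreeAlg k / (relOSym).  The theorem: the induced map
   FreeAlg k / (relNew) -> OSym, o |-> e_1, E_(2r) |-> e_(2r),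
   is surjective (first conjunct) and injective (second conjunct). *)
Theorem mainTheorem5 (k : closedFieldType) (hk : (2%:R : k) != 0) :
  (forall p : FreeAlg k, exists q : FreeAlg k, in_ideal (@relOSym k) (p - phi q))
  /\
  (forall q : FreeAlg k, in_ideal (@relOSym k) (phi q) <-> in_ideal (@relNew k) q).
Proof.
split=> [p|q].
  (* The preimage is [psi p], written out. *)
  by exists (ev (fun i => inv_seq (eX k) i.+1) p); apply/pr_eq; rewrite phi_psi.
split; last exact: phi_relNew.
(* Injectivity: apply [psi] to [phi q], which gives back [q] exactly. *)
by move/(psi_relOSym hk); rewrite psi_phi.
Qed.
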